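(* Let $a$ be a proper impedance on the bounded interval $I$ and $x_0\in\overline I$. Then: (i) For all $m,n\in\mathbb{N}_0$, $$\mathbf{D}_a^{(m)}\varphi_a^{(n)}=\begin{cases} n(n-1)\cdots(n-m+1)\,\varphi_{a^{(-1)^m}}^{(n-m)}, & n\ge m,\\ 0,& \text{otherwise.}\end{cases}$$ (ii) For all $m\in\mathbb{N}_0$, $\mathbf{J}_a^{(m)}[1]=\frac{1}{m!}\varphi_a^{(m)}$. (iii) If $\widehat p=\sum_{k=0}^{N}\alpha_k\varphi_a^{(k)}$ with $\alpha_0,\dots,\alpha_N\in\mathbb{C}$, then $$\widehat p=\sum_{k=0}^{N}\frac{\mathbf{D}_a^{(k)}\widehat p(x_0)}{k!}\varphi_a^{(k)}.$$
   Context: Let $I\subset\mathbb{R}$ be a bounded interval with closure $\overline I$, and fix $x_0\in\overline I$. A proper impedance on $I$ is a positive measurable function $a\in L^2(I)$ with $\frac1a\in L^2(I)$; then $\frac1a$ is also a proper impedance. For a proper impedance $a$ define $\mathbf{D}_a u:=a^2u'$ (for $u\in W^{1,1}(I)$) and $\mathbf{J}_a v(x):=\int_{x_0}^x\frac{v(t)}{a^2(t)}\,dt$. The formal powers associated with $a$ are $\varphi_a^{(0)}:=1$, $\varphi_a^{(1)}:=\mathbf{J}_a[1]$, $\varphi_a^{(k)}:=k(k-1)\mathbf{J}_a\mathbf{J}_{1/a}\varphi_a^{(k-2)}$ for $k\ge2$; all operators and formal powers for $\frac1a$ are obtained by replacing $a$ with $\frac1a$ (same $x_0$). The symbol $a^{(-1)^m}$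 means $a$ if $m$ is even and $\frac1a$ if $m$ is odd. Generalized derivatives and integrals: $\mathbf{D}_a^{(0)}:=\mathbf{I}$, $\mathbf{D}_a^{(m)}:=\mathbf{D}_{a^{(-1)^{m-1}}}\mathbf{D}_a^{(m-1)}$ and $\mathbf{J}_a^{(0)}:=\mathbf{I}$, $\mathbf{J}_a^{(m)}:=\mathbf{J}_a^{(m-1)}\mathbf{J}_{a^{(-1)^{m-1}}}$ for $m\ge1$, where $\mathbf{I}$ is the identity operator. $\mathbb{N}_0=\mathbb{N}\cup\{0\}$. *)

(* Defs.v *)
From HB Require Import structures.
From mathcomp Require Import all_boot all_order all_algebra.
From mathcomp Require Import all_classical all_reals all_analysis.
From mathcomp Require Import complex.

Set Implicit Arguments.
Unset Strict Implicit.
Unset Printing Implicit Defensive.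

Import Order.TTheory GRing.Theory Num.Theory.
Import numFieldNormedType.Exports.

Local Open Scope classical_set_scope.
Local Open Scope complex_scope.
Local Open Scope ring_scope.

(* Elements of function spaces on I are represented by total functions of type
   R -> R[i]; only their values on the closure of I matter, and elements of
   L^1(I) are compared almost everywhere on I. *)

Section Impedance.
Context {R : realType}.
Implicit Types (I : set R) (a : R -> R) (u v w g : R -> R[i]).

Local Notation mu := (@lebesgue_measure R).

Definition Cintegrable I u : Prop :=
  mu.-integrable I (EFin \o (fun x => complex.Re (u x))) /\
  mu.-integrable I (EFin \o (fun x => complex.Im (u x))).

Definition Cintegral I u : R[i] :=
  (\int[mu]_(x in I) complex.Re (u x)) +i* (\int[mu]_(x in I) complex.Im (u x)).

Definition oriented_integral (x0 x : R) v : R[i] :=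
  if x0 <= x then Cintegral `[x0, x] v else - Cintegral `[x, x0] v.

Definition square_integrable I a : Prop :=
  measurable_fun I a /\ mu.-integrable I (EFin \o (fun x => a x ^+ 2)).

Definition inv_imp a : R -> R := fun x => (a x)^-1.

Definition proper_impedance I a : Prop :=
  [/\ forall x, I x -> 0 < a x, square_integrable I a
    & square_integrable I (inv_imp a)].

(* a^{(-1)^m} *)
Definition alt_imp a (m : nat) : R -> R := if odd m then inv_imp a else a.

(* C^1_c of the interior of I: the test functions in Brezis' definition of
   W^{1,p}(I) for an interval I of the line. *)
Definition test_function I (f : R -> R) : Prop :=
  [/\ forall x, derivable f x 1, continuous f^`()%classic,
      compact (closure [set x | f x != 0])
    & closure [set x | f x != 0] `<=` I°].

Definition weak_derivative I u g : Prop :=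
  Cintegrable I g /\
  forall f, test_function I f ->
    Cintegral I (fun x => u x * (f^`()%classic x)%:C) =
    - Cintegral I (fun x => g x * (f x)%:C).

Definition W11 I u : Prop := Cintegrable I u /\ exists g, weak_derivative I u g.

(* u', a representative of the weak derivative (junk value 0 if there is
   none). *)
Definition wderive I u : R -> R[i] :=
  xget (fun=> 0) [set g | weak_derivative I u g].

Definition D_op I a u : R -> R[i] := fun x => (a x ^+ 2)%:C * wderive I u x.

Definition J_op a (x0 : R) v : R -> R[i] :=
  fun x => oriented_integral x0 x (fun t => v t / (a t ^+ 2)%:C).

Fixpoint formal_power a (x0 : R) (n : nat) : R -> R[i] :=
  match n with
  | 0 => fun=> 1
  | 1 => J_op a x0 (fun=> 1)
  | (k.+1 as k1).+1 => fun x =>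
      (k1.+1 * k1)%:R * J_op a x0 (J_op (inv_imp a) x0 (formal_power a x0 k)) x
  end.

Fixpoint D_iter I a (m : nat) u : R -> R[i] :=
  if m is m'.+1 then D_op I (alt_imp a m') (D_iter I a m' u) else u.

(* u lies in the domain of D_a^{(m)}: each derivative is taken of an element of
   W^{1,1}(I). *)
Definition D_iter_dom I a (m : nat) u : Prop :=
  forall j, (j < m)%N -> W11 I (D_iter I a j u).

Fixpoint J_iter a (x0 : R) (m : nat) v : R -> R[i] :=
  if m is m'.+1 then J_iter a x0 m' (J_op (alt_imp a m') x0 v) else v.

(* An element of W^{1,1}(I) is evaluated at points of the closure of I through
   its continuous representative. *)
Definition continuous_rep I u w : Prop :=
  [/\ {within closure I, continuous (fun x => complex.Re (w x))},
      {within closure I, continuous (fun x => complex.Im (w x))}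
    & u = w %[ae mu in I]].

Definition value_at I u (x : R) : R[i] :=
  xget (fun=> 0) [set w | continuous_rep I u w] x.

End Impedance.

(* Main.v *)
(* On the closure [l, r] of I, the formal powers satisfy
   phi_a^(n) = n J_a phi_{1/a}^(n-1), which gives (ii) by induction on m.
   D_a J_a v = v for continuous v: Fubini's theorem shows that v / a^2 is a weak
   derivative of J_a v, and weak derivatives are unique almost everywhere (du
   Bois-Reymond), because the test functions q / (q + e), with q >= 0 of class C^1
   and positive exactly on ]c, d[, tend to the indicator of ]c, d[ as e -> 0.
   Hence D_a^(k) of a combination of formal powers can be computed termwise; this
   is (i), and evaluation at x0, where phi_a^(n) vanishes for n > 0, is (iii). *)
Require Import Defs.
From mathcomp Require Import all_boot all_order all_algebra.
From mathcomp Require Import all_classical all_reals all_analysis.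
From mathcomp Require Import measurable_realfun complex ring lra.
Import Order.TTheory GRing.Theory Num.Theory.
Import numFieldNormedType.Exports.
Local Open Scope classical_set_scope.
Local Open Scope complex_scope.
Local Open Scope ring_scope.

Set Implicit Arguments.
Unset Strict Implicit.

(** * Bounded intervals *)

(** [wderive] selects an arbitrary weak derivative, so [D_iter] is known only almost everywhere,
    whereas (iii) evaluates at a single point, possibly an endpoint outside [I]. Each iterate is
    therefore compared with an explicit continuous function on [l, r], and integrals are moved
    freely between [I], ]l, r[ and [l, r]. Measurability (for Borel sets) can be lost by a change on
    a null set, yet integrability includes it; it is thus carried through the induction on the order
    of the derivative as a conclusion of its own. The iterates are not pure images of J: the term of
    index k leaves the constant alpha_k k!. The statement to iterate is hence the one for z + J_a v
    with z constant; the next derivative erases z, and z is the value at x0. Since 1/a is only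
    square integrable, v / a^2 is merely integrable and the primitive need not be C^1; this is why
    integration by parts goes through a double integral. *)

Lemma ae_itv_dense (R : realType) (l r x e : R) (P : R -> Prop) :
  l < r -> x \in `[l, r] -> 0 < e ->
  {ae lebesgue_measure, forall y, y \in `]l, r[ -> P y} ->
  exists y, [/\ y \in `]l, r[, `|x - y| < e & P y].
Proof.
move=> lr /[!in_itv]/= /andP[lx xr] e0 [N [mN N0 subN]].
apply: contrapT => nex.
(* If no such point existed, the exceptional null set would contain ]s, t[, which has positive
   length. Taking max and min with [l] and [r] covers the case where [x] is an endpoint. *)
set s := Num.max l (x - e); set t := Num.min r (x + e).
have st : s < t.
  by rewrite /s /t gt_max !lt_min lr /= ltrBlDr; apply/and3P; split=> //; lra.
suff : (lebesgue_measure `]s, t[%classic <= lebesgue_measure N)%E.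
  by rewrite N0 lebesgue_measure_itv/= lte_fin st leNgt -EFinB lte_fin subr_gt0 st.
apply: le_measure; rewrite ?inE//.
move=> y /=; rewrite in_itv/= /s /t gt_max lt_min => /andP[/andP[ly xy] /andP[yr yx]].
apply: subN => /= Py; apply: nex; exists y; split.
- by rewrite in_itv/= ly.
- by rewrite ltr_norml; apply/andP; split; lra.
- by apply: Py; rewrite in_itv/= ly.
Qed.

Lemma closure_itv_bnd (R : realType) (l r : R) (b c : bool) : l < r ->
  closure [set` Interval (BSide b l) (BSide c r)] = `[l, r]%classic.
Proof.
move=> lr; apply/seteqP; split.
- have cl : closed `[l, r]%classic by exact: itv_closed.
  rewrite [X in _ `<=` X](closure_id _).1//; apply: closureS => x /=.
  by apply: subset_itvScc; rewrite ?bnd_simp.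
- move=> x /= xlr B /nbhs_ballP[e /= e0 eB].
  have [|y [ylr xy _]] := @ae_itv_dense R l r x e (fun=> True) lr xlr e0.
    exact: aeW.
  exists y; split; last exact: eB.
  by move: ylr; rewrite /=; apply: subset_itvW.
Qed.

Lemma bounded_intervalP (R : realType) (I : set R) :
  is_interval I -> bounded_set I -> I° !=set0 ->
  exists l r b c, l < r /\ I = [set` Interval (BSide b l) (BSide c r)].
Proof.
move=> /is_intervalP IE [M [_ /(_ (M + 1))]]; rewrite ltrDl => /(_ ltr01) /= IM [x0 Ix0].
have Il : has_lbound I.
  by exists (- (M + 1)) => x /IM; rewrite ler_norml => /andP[].
have Iu : has_ubound I by exists (M + 1) => x /IM; rewrite ler_norml => /andP[].
move: IE; rewrite /Rhull (asboolT Il) (asboolT Iu) => IE.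
(* As an upper bound, [BSide true] excludes the endpoint, hence the negation on the right only. The
   nonempty interior then forces l < r. *)
exists (inf I), (sup I), `[< I (inf I) >], (~~ `[< I (sup I) >]); split => //.
move: Ix0; rewrite [X in X° _]IE interior_itv_bnd /= in_itv/= => /andP[].
exact: lt_trans.
Qed.

(** If the values at [x] differed by e > 0, continuity would keep each function within e/2 of its
    value near [x], and a nearby point of equality would give e < e. The endpoints are included
    because x0 may be one. *)
Lemma ae_eq_within_continuous (R : realType) (l r : R) (f g : R -> R) : l < r ->
  {within `[l, r], continuous f} -> {within `[l, r], continuous g} ->
  {ae lebesgue_measure, forall y, y \in `]l, r[ -> f y = g y} ->
  forall x, x \in `[l, r] -> f x = g x.
Proof.
move=> lr cf cg fg x xlr; apply: contrapT => /eqP; rewrite -subr_eq0 -normr_gt0.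
set e := `|_| => e0.
have := (subspace_continuousP _ _).1 cf x xlr.
move=> /cvgrPdist_lt/(_ _ (divr_gt0 e0 (ltr0Sn _ 1))) nf.
have := (subspace_continuousP _ _).1 cg x xlr.
move=> /cvgrPdist_lt/(_ _ (divr_gt0 e0 (ltr0Sn _ 1))) ng.
have /nbhs_ballP[d /= d0 dB] : within `[l, r]%classic (nbhs x)
    [set y | `|f x - f y| < e / 2 /\ `|g x - g y| < e / 2] by exact: filterI.
have [y [ylr xy fgy]] := ae_itv_dense lr xlr d0 fg.
have [|] := dB y xy; first exact: subset_itvW ylr.
rewrite fgy => h1 h2; have : e < e; last by rewrite ltxx.
rewrite {1}/e (_ : f x - g x = (f x - g y) - (g x - g y)); last by ring.
rewrite (le_lt_trans (ler_normB _ _))// [ltRHS](splitr e) ltrD//.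
Qed.

(** * Integration by parts for primitives of integrable functions *)

Lemma segment_continuous_bounded (R : realType) (l r : R) (f : R -> R) :
  {within `[l, r], continuous f} -> [bounded f x | x in `[l, r]%classic].
Proof.
move=> cf; have /compact_bounded[M [rM fM]] :=
  continuous_compact cf (@segment_compact R l r).
by exists M; split=> // x Mx y /= ylr; apply: (fM x Mx); exists y.
Qed.

(** By Tonelli the double integral of the absolute value is the product of the two norms. This
    provides the majorant for the application of Fubini below. *)
Lemma integrable_tensor (R : realType) (p q : R -> R) :
  lebesgue_measure.-integrable [set: R] (EFin \o p) ->
  lebesgue_measure.-integrable [set: R] (EFin \o q) ->
  (@lebesgue_measure R \x @lebesgue_measure R)%E.-integrable [set: _]
    (fun z => (p z.1 * q z.2)%:E).
Proof.
move=> /integrableP[/measurable_EFinP mp ip] /integrableP[/measurable_EFinP mq iq].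
apply/integrable12ltyP.
  apply/measurable_EFinP/measurable_funM.
  - exact: (measurableT_comp mp measurable_fst).
  - exact: (measurableT_comp mq measurable_snd).
rewrite [ltLHS](_ : _ = \int[lebesgue_measure]_x
    ((\int[lebesgue_measure]_t `|(q t)%:E|) * `|(p x)%:E|))%E; last first.
  apply: eq_integral => x _.
  under eq_integral do rewrite /= normrM EFinM.
  rewrite muleC ge0_integralZl//.
  by apply/measurable_EFinP; exact: measurableT_comp.
rewrite ge0_integralZl//; last 2 first.
- by apply/measurable_EFinP; exact: measurableT_comp.
- exact: integral_ge0.
by rewrite lte_mul_pinfty// ?integral_ge0// ge0_fin_numE// integral_ge0.
Qed.

(** Both sides integrate h(t) f'(x) over the triangle l <= t <= x <= r. Integrating in t first gives
    the left side; integrating in x first gives f(r) - f(t) = - f(t). *)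
Lemma integral_primitive_mul_derive (R : realType) (l r : R) (h f : R -> R) :
  l < r -> lebesgue_measure.-integrable `[l, r] (EFin \o h) ->
  (forall x, derivable f x 1) -> continuous f^`()%classic ->
  f l = 0 -> f r = 0 ->
  \int[lebesgue_measure]_(x in `[l, r])
    ((\int[lebesgue_measure]_(t in `[l, x]) h t) * f^`()%classic x)
  = - \int[lebesgue_measure]_(t in `[l, r]) (h t * f t).
Proof.
set mu := @lebesgue_measure R => lr ih df cf fl fr.
have mlr : measurable `[l, r]%classic by exact: measurable_itv.
pose p := f^`()%classic \_ `[l, r]; pose q := h \_ `[l, r].
have ip : mu.-integrable [set: R] (EFin \o p).
  rewrite -restrict_EFin; apply/integrable_restrict => //=; rewrite setTI.
  apply: continuous_compact_integrable; first exact: segment_compact.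
  exact: continuous_subspaceT.
have iq : mu.-integrable [set: R] (EFin \o q).
  by rewrite -restrict_EFin; apply/integrable_restrict => //=; rewrite setTI.
(* [p] and [q] extend f' and h by zero outside [l, r], so that Fubini can be applied on the whole
   plane; the test [z.2 <= z.1] cuts out the triangle. *)
pose K (z : R * R) : \bar R := if z.2 <= z.1 then (p z.1 * q z.2)%:E else 0%E.
have iK : (mu \x mu)%E.-integrable [set: _] K.
  apply: le_integrable (integrable_tensor ip iq) => //.
    apply: measurable_fun_ifT => //.
      by apply: measurable_fun_ler; [exact: measurable_snd|exact: measurable_fst].
    exact: (measurable_int _ (integrable_tensor ip iq)).
  by move=> z _; rewrite /K; case: ifP => _ //; rewrite abse0.
have := Fubini iK; rewrite -/mu.
have -> : (\int[mu]_x \int[mu]_t K (x, t) = \int[mu]_(x in `[l, r])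
    ((\int[mu]_(t in `[l, x]) h t) * f^`()%classic x)%:E)%E.
  rewrite [RHS]integral_mkcond; apply: eq_integral => x _.
  rewrite patchE; case: ifPn => [|xlr]; last first.
    rewrite integral0_eq// => t _; rewrite /K /=; case: ifP => // _.
    by rewrite /p patchE (negbTE xlr) mul0r.
  rewrite inE/= => xlr; have := xlr; rewrite in_itv/= => /andP[lx xr].
  have sx : `[l, x] `<=` `[l, r] by apply: subset_itvl; rewrite bnd_simp.
  have ihx : mu.-integrable `[l, x] (EFin \o h).
    exact: integrableS ih.
  rewrite /Rintegral EFinM fineK; last exact: integrable_fin_num.
  rewrite muleC -integralZl//= [RHS]integral_mkcond; apply: eq_integral => t _.
  rewrite /K /= patchE [in RHS]mem_setE in_itv/=.
  rewrite /p /q !patchE !mem_setE !in_itv/= lx xr/=.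
  case: (leP t x) => tx; last by rewrite andbF.
  by rewrite (le_trans tx xr) !andbT; case: ifP => _; rewrite ?mulr0 ?EFinM.
have -> : (\int[mu]_t \int[mu]_x K (x, t) = \int[mu]_(t in `[l, r])
    (- (h t * f t))%:E)%E.
  rewrite [RHS]integral_mkcond; apply: eq_integral => t _.
  rewrite patchE; case: ifPn => [|tlr]; last first.
    rewrite integral0_eq// => x _; rewrite /K /=; case: ifP => // _.
    by rewrite /q patchE (negbTE tlr) mulr0.
  rewrite inE/= => tlr; have := tlr; rewrite in_itv/= => /andP[lt tr].
  transitivity (\int[mu]_(x in `[t, r]) ((h t)%:E * (f^`()%classic x)%:E))%E.
    rewrite [RHS]integral_mkcond; apply: eq_integral => x _.
    rewrite /K /= patchE [in RHS]mem_setE in_itv/=.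
    rewrite /p /q !patchE !mem_setE !in_itv/= lt tr/=.
    case: (leP t x) => tx //=.
    by rewrite (le_trans lt tx)/=; case: ifP => _; rewrite ?mul0r// EFinM muleC.
  have cf' : {within `[t, r], continuous f^`()%classic} by exact: continuous_subspaceT.
  rewrite integralZl//; last first.
    apply: continuous_compact_integrable => //; exact: segment_compact.
  (* The fundamental theorem requires t < r; for t = r the integral is over a point and f(r) = 0. *)
  move: tr; rewrite le_eqVlt => /predU1P[->|tr].
    by rewrite set_itv1 integral_set1 mule0 fr mulr0 oppr0.
  have fc : continuous f.
    by move=> x; apply: differentiable_continuous; apply/derivable1_diffP.
  rewrite (@continuous_FTC2 _ _ f)// ?fr ?sub0e; last first.
    split => //.
    - by apply: cvg_at_right_filter; exact: fc.
    - by apply: cvg_at_left_filter; exact: fc.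
  by rewrite -EFinN -EFinM mulrN.
move=> /(congr1 fine) E; rewrite [LHS]E.
rewrite -mulN1r -RintegralZl//.
  by rewrite /Rintegral; congr fine; apply: eq_integral => x _; rewrite mulN1r.
have fc : {within `[l, r], continuous f}.
  apply: continuous_subspaceT => x.
  by apply: differentiable_continuous; apply/derivable1_diffP.
have := @integrableMl _ _ _ mu _ mlr _ f ih; apply.
- exact: subspace_continuous_measurable_fun.
- exact: segment_continuous_bounded.
Qed.

(** * The du Bois-Reymond lemma *)

(** Squaring makes the positive part C^1, exactly the regularity that [test_function] asks for; it
    takes the place of the usual exponential bump. *)
Definition sqr_pos (R : realType) (x : R) : R := Num.max x 0 ^+ 2.

Lemma is_derive_sqr_pos (R : realType) (x : R) :
  is_derive x 1 (@sqr_pos R) (2 * Num.max x 0).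
Proof.
(* [`|sqr_pos (h + x) - sqr_pos x - 2 * h * max x 0| <= h ^ 2] for all [x] and [h] *)
suff H : h^-1 *: (sqr_pos (h *: 1 + x) - sqr_pos x) @[h --> 0^'] -->
    2 * Num.max x 0.
  by apply: DeriveDef; [apply/cvg_ex; eexists; exact: H|exact: (cvg_lim _ H)].
apply/cvgrPdist_lt => e e0; near=> h.
have h0 : h != 0 by near: h; exact: nbhs_dnbhs_neq.
rewrite (@le_lt_trans _ _ `|h|)//; last first.
  by near: h; exact: dnbhs0_lt.
rewrite -(@ler_pM2l _ `|h|) ?normr_gt0// -normrM -normrM.
rewrite /GRing.scale /= mulr1 mulrBr mulVKf// (ger0_norm (sqr_ge0 h)).
rewrite ler_norml /sqr_pos.
by case: (lerP (h + x) 0) => ?; case: (lerP x 0) => ?; apply/andP; split; nra.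
Unshelve. all: by end_near. Qed.

Lemma continuous_sqr_pos (R : realType) : continuous (@sqr_pos R).
Proof.
move=> x; apply: differentiable_continuous; apply/derivable1_diffP.
exact: (@ex_derive _ _ _ _ _ _ _ (is_derive_sqr_pos x)).
Qed.

Definition sqr_bump (R : realType) (c d x : R) : R := sqr_pos (x - c) * sqr_pos (d - x).

Definition dsqr_bump (R : realType) (c d x : R) : R :=
  2 * Num.max (x - c) 0 * sqr_pos (d - x) - 2 * Num.max (d - x) 0 * sqr_pos (x - c).

Lemma is_derive_sqr_bump (R : realType) (c d x : R) :
  is_derive x 1 (sqr_bump c d) (dsqr_bump c d x).
Proof.
have Hc : is_derive x 1 (fun y => y - c) 1.
  by apply: is_derive_eq; rewrite subr0.
have Hd : is_derive x 1 (fun y => d - y) (- 1).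
  by apply: is_derive_eq; rewrite add0r mul1r.
have H := is_deriveM
  (@is_derive1_comp _ (@sqr_pos R) (fun y => y - c) _ _ _ (is_derive_sqr_pos _) Hc)
  (@is_derive1_comp _ (@sqr_pos R) (fun y => d - y) _ _ _ (is_derive_sqr_pos _) Hd).
by apply: is_derive_eq; rewrite /dsqr_bump /GRing.scale /=; ring.
Qed.

Lemma continuous_dsqr_bump (R : realType) (c d : R) : continuous (dsqr_bump c d).
Proof.
have cB : continuous (fun y => y - c) by move=> x; apply: cvgB => //; exact: cvg_cst.
have cd' : continuous (fun y => d - y) by move=> x; apply: cvgB => //; exact: cvg_cst.
have cm (g : R -> R) : continuous g -> continuous (fun y => 2 * Num.max (g y) 0).
  move=> cg x; apply: cvgM; first exact: cvg_cst.
  by apply: (@continuous_max _ _ g (fun=> 0)); [exact: cg|exact: cvg_cst].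
have cs (g : R -> R) : continuous g -> continuous (fun y => sqr_pos (g y)).
  by move=> cg x; apply: continuous_comp; [exact: cg|exact: continuous_sqr_pos].
by move=> x; apply: cvgB; apply: cvgM;
  [exact: (cm _ cB)|exact: (cs _ cd')|exact: (cm _ cd')|exact: (cs _ cB)].
Qed.

Lemma sqr_bump_ge0 (R : realType) (c d x : R) : 0 <= sqr_bump c d x.
Proof. by rewrite mulr_ge0 ?sqr_ge0. Qed.

Lemma sqr_bump_neq0 (R : realType) (c d x : R) : (sqr_bump c d x != 0) = (x \in `]c, d[).
Proof.
have H (y : R) : (sqr_pos y != 0) = (0 < y).
  by rewrite expf_eq0 /=; case: (leP y 0) => y0; rewrite ?eqxx// gt_eqF.
by rewrite mulf_eq0 negb_or !H in_itv/= !subr_gt0.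
Qed.

(* [sqr_bump / (sqr_bump + e)], written so that it is easy to differentiate. *)
Definition plateau (R : realType) (c d e x : R) : R := 1 - e * (sqr_bump c d x + e)^-1.

Lemma plateau_bound (R : realType) (c d e x : R) : 0 < e -> 0 <= plateau c d e x <= 1.
Proof.
move=> e0; have b0 := sqr_bump_ge0 c d x; rewrite /plateau subr_ge0 lerBlDr lerDl.
by rewrite mulr_ge0 ?invr_ge0 ?addr_ge0 ?(ltW e0)// andbT ler_pdivrMr ?mul1r ?lerDr ?ltr_wpDl.
Qed.

Lemma plateau_eq0 (R : realType) (c d e x : R) : 0 < e -> x \notin `]c, d[ ->
  plateau c d e x = 0.
Proof.
move=> e0; rewrite -sqr_bump_neq0 negbK => /eqP b0.
by rewrite /plateau b0 add0r divff ?subrr// gt_eqF.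
Qed.

Lemma is_derive_plateau (R : realType) (c d e x : R) : 0 < e ->
  is_derive x 1 (plateau c d e) (e * dsqr_bump c d x / (sqr_bump c d x + e) ^+ 2).
Proof.
move=> e0; have b0 := sqr_bump_ge0 c d x.
have nz : sqr_bump c d x + e != 0 by rewrite gt_eqF// ltr_wpDl.
have Hb := is_derive_sqr_bump c d x.
have He : is_derive x 1 (fun y => sqr_bump c d y + e) (dsqr_bump c d x).
  by apply: is_derive_eq; rewrite addr0.
have Hv := @is_deriveV _ (fun y => sqr_bump c d y + e) x _ _ nz He.
have H := is_deriveB (is_derive_cst (1 : R) x (1 : R)) (is_deriveZ e Hv).
by apply: is_derive_eq; rewrite /GRing.scale /= -exprVn; ring.
Qed.

(** The closed support lies in [c, d]; the strict inequalities l < c and d < r place this compact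
    set inside the open interval. *)
Lemma plateau_test (R : realType) (l r c d e : R) : l < c -> d < r -> 0 < e ->
  test_function `]l, r[%classic (plateau c d e).
Proof.
move=> lc dr e0.
have sub : closure [set x | plateau c d e x != 0] `<=` `[c, d]%classic.
  rewrite [X in _ `<=` X](closure_id _).1; last exact: itv_closed.
  apply: closureS => x /=; apply: contraNT => xcd; rewrite plateau_eq0//.
  by apply: contra xcd; exact: subset_itv_oo_cc.
split.
- by move=> x; have [] := is_derive_plateau c d x e0.
- rewrite (_ : _^`()%classic =
      fun x => e * dsqr_bump c d x / (sqr_bump c d x + e) ^+ 2); last first.
    by apply/funext => x; rewrite derive1E; have [] := is_derive_plateau c d x e0.
  have cb : continuous (sqr_bump c d).
    move=> x; apply: differentiable_continuous; apply/derivable1_diffP.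
    by have [] := is_derive_sqr_bump c d x.
  move=> x; apply: cvgM.
    by apply: cvgM; [exact: cvg_cst|exact: continuous_dsqr_bump].
  apply: cvgV; first by rewrite expf_neq0// gt_eqF// ltr_wpDl// sqr_bump_ge0.
  by apply: cvgM; apply: cvgD; [exact: cb|exact: cvg_cst|exact: cb|exact: cvg_cst].
- apply: subclosed_compact sub; [exact: closed_closure|exact: segment_compact].
- rewrite interior_itv_bnd; apply: subset_trans sub _.
  by apply: subset_itv; rewrite bnd_simp.
Qed.

(** Dominated convergence for the plateaus with e = 1/(n+1); they take values in [0, 1], so |g| is a
    majorant. *)
Lemma integral_itv_eq0 (R : realType) (l r c d : R) (g : R -> R) :
  lebesgue_measure.-integrable `]l, r[ (EFin \o g) ->
  (forall f, test_function `]l, r[%classic f ->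
    \int[lebesgue_measure]_(x in `]l, r[) (g x * f x) = 0) ->
  l < c -> d < r -> \int[lebesgue_measure]_(x in `]c, d[) g x = 0.
Proof.
set mu := @lebesgue_measure R => ig g0 lc dr.
have mlr : measurable `]l, r[%classic by exact: measurable_itv.
have mg : measurable_fun `]l, r[ g by apply/measurable_EFinP; exact: (measurable_int _ ig).
pose p n := plateau c d n.+1%:R^-1.
have tp n : test_function `]l, r[%classic (p n) by apply: plateau_test.
have mp n : measurable_fun `]l, r[ (p n).
  apply: measurable_funTS; apply: continuous_measurable_fun => x.
  apply: differentiable_continuous; apply/derivable1_diffP.
  by have [] := tp n.
have pb n x : 0 <= p n x <= 1 by exact: plateau_bound.
have [|||||_ _ H] := @dominated_convergence _ _ _ mu _ mlr
  (fun n x => (g x * p n x)%:E) (fun x => (g x * \1_(`]c, d[) x)%:E)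
  (fun x => `|g x|%:E).
- by move=> n; apply/measurable_EFinP/measurable_funM; [exact: mg|exact: mp].
- by apply/measurable_EFinP/measurable_funM => //; exact: measurable_indic.
(* Off ]c, d[ every plateau vanishes. On ]c, d[ the bump is positive, so e / (bump + e) tends to 0 /
   bump = 0. *)
- apply: aeW => x _; apply: cvg_EFin; first exact: nearW.
  apply: cvgM; first exact: cvg_cst.
  rewrite indicE mem_setE; case: (boolP (x \in _)) => xcd; last first.
    rewrite (_ : (p^~ x) = fun=> 0); first exact: cvg_cst.
    by apply/funext => n; rewrite /p plateau_eq0.
  have b0 : sqr_bump c d x != 0 by rewrite sqr_bump_neq0.
  rewrite -[X in _ --> X]subr0; apply: cvgB; first exact: cvg_cst.
  rewrite -[X in _ --> X](mul0r (sqr_bump c d x + 0)^-1); apply: cvgM.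
    exact: cvg_harmonic.
  apply: cvgV; first by rewrite addr0.
  by apply: cvgD; [exact: cvg_cst|exact: cvg_harmonic].
- exact: integrable_norm ig.
- apply: aeW => x n _; rewrite lee_fin normrM ler_piMr//.
  by have /andP[h1 h2] := pb n x; rewrite ger0_norm.
(* The hypothesis only says that [fine] of the integral is 0, which an infinite integral would
   satisfy as well; integrability of the product excludes that case. *)
have E : [sequence (\int[mu]_(x in `]l, r[) (g x * p n x)%:E)%E]_n
    = (cst 0%E : nat -> \bar R).
  apply/funext => n /=; rewrite -[RHS](_ : (0 : R)%:E = 0%E)// -(g0 _ (tp n)) fineK//.
  apply: integrable_fin_num => //.
  have := @integrableMl _ _ _ mu _ mlr _ (p n) ig; apply; first exact: mp.
  exists 1; split=> // y y1 x _ /=; have /andP[h1 h2] := pb n x.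
  by rewrite ger0_norm// (le_trans h2)// ltW.
have {}H := cvg_unique _ H (eq_ind_r (fun u => u @ \oo --> 0%E) (cvg_cst _) E).
have -> : \int[mu]_(x in `]c, d[) g x = \int[mu]_(x in `]l, r[) (g x * \1_(`]c, d[) x).
  rewrite [LHS]Rintegral_mkcond [RHS]Rintegral_mkcond.
  apply: eq_Rintegral => x _; rewrite !patchE indicE !mem_setE.
  case: ifPn => xcd.
    rewrite (_ : x \in `]l, r[) ?mulr1//.
    by apply: subset_itv xcd; rewrite bnd_simp ltW.
  by rewrite mulr0; case: ifP.
by rewrite /Rintegral H.
Qed.

(** By Lebesgue differentiation, [g] is almost everywhere the derivative of the primitive of its
    extension by zero, so it suffices that this primitive be locally constant. *)
Lemma du_bois_reymond (R : realType) (l r : R) (g : R -> R) :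
  lebesgue_measure.-integrable `]l, r[ (EFin \o g) ->
  (forall f, test_function `]l, r[%classic f ->
    \int[lebesgue_measure]_(x in `]l, r[) (g x * f x) = 0) ->
  {ae lebesgue_measure, forall x, x \in `]l, r[ -> g x = 0}.
Proof.
set mu := @lebesgue_measure R => ig g0.
have mlr : measurable `]l, r[%classic by exact: measurable_itv.
pose G := g \_ `]l, r[.
have iG : mu.-integrable [set: R] (EFin \o G).
  by rewrite -restrict_EFin; apply/integrable_restrict => //=; rewrite setTI.
have iGy y : mu.-integrable `]-oo, y] (EFin \o G).
  by apply: integrableS iG => //; exact: measurable_itv.
have := FTC1Ny iGy (integrable_locally mlr ig).
apply: filterS; first exact: (ae_filter_ringOfSetsType mu).
move=> x [_ +] xlr; rewrite {2}/G patchE mem_setE xlr => <-.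
(* By [integral_itv_eq0], [F] is constant on [`]l, r[]. *)
set F := fun y : R => \int[mu]_(t in `]-oo, y]) G t.
have F_lt y z : y < z -> y \in `]l, r[ -> z \in `]l, r[ -> F z = F y.
  rewrite !in_itv/= => yz /andP[ly yr] /andP[lz zr].
  apply/eqP; rewrite -subr_eq0 /F Rintegral_itvB//=; last by rewrite bnd_simp ltW.
  rewrite -Rintegral_itv_bndo_bndc; last first.
    by apply: integrableS iG => //; exact: measurable_itv.
  rewrite -(@integral_itv_eq0 R l r y z g ig g0 ly zr); apply/eqP/eq_Rintegral => t.
  rewrite inE/= in_itv/= => /andP[yt tz].
  by rewrite /G patchE mem_setE in_itv/= (lt_trans ly yt) (lt_trans tz zr).
have Fx : \forall y \near x, F y = cst (F x) y.
  have : \forall y \near x, y \in `]l, r[.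
    by apply: open_nbhs_nbhs; split => //; exact: itv_open.
  apply: filterS => y ylr; case: (ltgtP x y) => [xy|yx|->//].
  - exact: F_lt.
  - by rewrite /=; apply/esym/F_lt.
by rewrite derive1E (near_eq_derive _ Fx) derive_cst.
Qed.

(** * Oriented integrals *)

(** Endpoints are null, so integrability on the open interval settles all four kinds of interval,
    whatever values the function takes at the ends. *)
Lemma integrable_itv_bndoo (R : realType) (l r : R) (b c : bool) (f : R -> R) :
  lebesgue_measure.-integrable `]l, r[ (EFin \o f) ->
  lebesgue_measure.-integrable [set` Interval (BSide b l) (BSide c r)] (EFin \o f).
Proof.
move=> /integrableP[mf fi]; apply/integrableP; split.
  move: mf; case: b c => -[].
  - by move=> /emeasurable_fun_itv_obnd_cbndP.
  - by move=> /emeasurable_fun_itv_obnd_cbndP/emeasurable_fun_itv_bndo_bndcP.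
  - by [].
  - by move=> /emeasurable_fun_itv_bndo_bndcP.
by rewrite integral_itv_bndoo//; exact: measurableT_comp.
Qed.

Lemma Rintegral_itv_bndoo (R : realType) (l r : R) (b c : bool) (f : R -> R) :
  measurable_fun `]l, r[ f ->
  \int[lebesgue_measure]_(x in [set` Interval (BSide b l) (BSide c r)]) f x
  = \int[lebesgue_measure]_(x in `]l, r[) f x.
Proof.
by move=> mf; rewrite /Rintegral integral_itv_bndoo//; exact/measurable_EFinP.
Qed.

Lemma test_function_itv (R : realType) (l r : R) (b c : bool) (f : R -> R) :
  test_function [set` Interval (BSide b l) (BSide c r)] f <->
  test_function `]l, r[%classic f.
Proof. by rewrite /test_function !interior_itv_bnd. Qed.

Lemma test_function_eq0 (R : realType) (l r x : R) (f : R -> R) :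
  test_function `]l, r[%classic f -> x \notin `]l, r[ -> f x = 0.
Proof.
move=> [_ _ _ sf]; apply: contraNeq => fx; have := sf x.
by rewrite interior_itv_bnd; apply; exact: subset_closure.
Qed.

Lemma test_function_continuous (R : realType) (I : set R) (f : R -> R) :
  test_function I f -> continuous f.
Proof.
move=> [df _ _ _] x; apply: differentiable_continuous; exact/derivable1_diffP.
Qed.

Lemma integrable_continuous_mul (R : realType) (l r : R) (f h : R -> R) :
  {within `[l, r], continuous f} ->
  lebesgue_measure.-integrable `[l, r] (EFin \o h) ->
  lebesgue_measure.-integrable `[l, r] (EFin \o (fun t => f t * h t)).
Proof.
move=> cf ih; have mlr : measurable `[l, r]%classic by exact: measurable_itv.
have := @integrableMr _ _ _ lebesgue_measure _ mlr f _ _ _ ih; apply.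
- exact: subspace_continuous_measurable_fun.
- exact: segment_continuous_bounded.
Qed.

Lemma ae_eq_integrable (R : realType) (A : set R) (f g : R -> R) :
  measurable A -> measurable_fun A g ->
  {ae lebesgue_measure, forall x, A x -> f x = g x} ->
  lebesgue_measure.-integrable A (EFin \o f) ->
  lebesgue_measure.-integrable A (EFin \o g).
Proof.
move=> mA mg fg /integrableP[mf fi]; apply/integrableP; split.
  exact/measurable_EFinP.
rewrite (_ : integral _ _ _ = (\int[lebesgue_measure]_(x in A) `|(f x)%:E|)%E)//.
apply: ae_eq_integral => //.
- by apply: measurableT_comp => //; exact/measurable_EFinP.
- exact: measurableT_comp.
move: fg; apply: filterS; first exact: (ae_filter_ringOfSetsType (@lebesgue_measure R)).
by move=> x /= fg /fg ->.
Qed.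

Lemma ae_eq_Rintegral (R : realType) (A : set R) (f g : R -> R) :
  measurable A -> measurable_fun A f -> measurable_fun A g ->
  {ae lebesgue_measure, forall x, A x -> f x = g x} ->
  \int[lebesgue_measure]_(x in A) f x = \int[lebesgue_measure]_(x in A) g x.
Proof.
move=> mA mf mg fg; congr fine; apply: ae_eq_integral => //.
- exact/measurable_EFinP.
- exact/measurable_EFinP.
move: fg; apply: filterS; first exact: (ae_filter_ringOfSetsType (@lebesgue_measure R)).
by move=> x /= fg /fg ->.
Qed.

Definition oriented_Rintegral (R : realType) (x0 x : R) (h : R -> R) : R :=
  if x0 <= x then \int[lebesgue_measure]_(t in `[x0, x]) h t
  else - \int[lebesgue_measure]_(t in `[x, x0]) h t.

(** Moving the base point to [l] removes the case distinction on the order of [x0] and [x]: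
    continuity and linearity then follow from ordinary primitives. *)
Lemma oriented_RintegralE (R : realType) (l r x0 x : R) (h : R -> R) :
  lebesgue_measure.-integrable `[l, r] (EFin \o h) ->
  x0 \in `[l, r] -> x \in `[l, r] ->
  oriented_Rintegral x0 x h =
    \int[lebesgue_measure]_(t in `[l, x]) h t
    - \int[lebesgue_measure]_(t in `[l, x0]) h t.
Proof.
move=> ih.
have H y z : y <= z -> y \in `[l, r] -> z \in `[l, r] ->
    \int[lebesgue_measure]_(t in `[y, z]) h t =
    \int[lebesgue_measure]_(t in `[l, z]) h t
    - \int[lebesgue_measure]_(t in `[l, y]) h t.
  rewrite !in_itv/= => yz /andP[ly yr] /andP[lz zr].
  rewrite (@Rintegral_itvB _ h (BLeft l) (BRight z) y)// ?bnd_simp//; last first.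
    apply: integrableS ih => //.
    by apply: subset_itvl; rewrite bnd_simp.
  rewrite Rintegral_itv_obnd_cbnd//.
  apply: integrableS ih => //.
  by apply: subset_itv; rewrite bnd_simp.
move=> x0lr xlr; rewrite /oriented_Rintegral; case: ifPn => [|/negbTE xx0].
  by move=> x0x; exact: H.
by rewrite H ?opprB// ltW// ltNge xx0.
Qed.

Lemma oriented_Rintegral_linear (R : realType) (l r x0 x p : R) (h k : R -> R) :
  lebesgue_measure.-integrable `[l, r] (EFin \o h) ->
  lebesgue_measure.-integrable `[l, r] (EFin \o k) ->
  x0 \in `[l, r] -> x \in `[l, r] ->
  oriented_Rintegral x0 x (fun t => p * h t + k t) =
    p * oriented_Rintegral x0 x h + oriented_Rintegral x0 x k.
Proof.
move=> ih ik x0lr xlr.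
have iph : lebesgue_measure.-integrable `[l, r] (EFin \o (fun t => p * h t)).
  by apply: integrable_continuous_mul ih; apply: continuous_subspaceT; exact: cst_continuous.
have iphk : lebesgue_measure.-integrable `[l, r] (EFin \o (fun t => p * h t + k t)).
  by apply: (integrableD _ iph ik); exact: measurable_itv.
have H y : y \in `[l, r] -> \int[lebesgue_measure]_(t in `[l, y]) (p * h t + k t) =
    p * \int[lebesgue_measure]_(t in `[l, y]) h t + \int[lebesgue_measure]_(t in `[l, y]) k t.
  rewrite in_itv/= => /andP[ly yr].
  have s : `[l, y] `<=` `[l, r] by apply: subset_itvl; rewrite bnd_simp.
  have my : measurable `[l, y]%classic by exact: measurable_itv.
  have mr : measurable `[l, r]%classic by exact: measurable_itv.
  rewrite RintegralD//; [rewrite RintegralZl//|..].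
  - exact: integrableS ih.
  - exact: integrableS iph.
  - exact: integrableS ik.
rewrite !(oriented_RintegralE _ x0lr xlr)// !H//; ring.
Qed.

Lemma oriented_Rintegral_continuous (R : realType) (l r x0 : R) (h : R -> R) :
  lebesgue_measure.-integrable `[l, r] (EFin \o h) -> x0 \in `[l, r] ->
  {within `[l, r], continuous (fun x => oriented_Rintegral x0 x h)}.
Proof.
move=> ih x0lr; have lr : l <= r by move: x0lr; rewrite in_itv/= => /andP[]; exact: le_trans.
apply: (@subspace_eq_continuous _ _ _ (fun x => \int[lebesgue_measure]_(t in `[l, x]) h t
    - \int[lebesgue_measure]_(t in `[l, x0]) h t)).
  by move=> x /set_mem xlr; rewrite /from_subspace (oriented_RintegralE ih).
move=> x; apply: cvgB; last exact: cvg_cst.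
exact: (parameterized_integral_continuous lr ih).
Qed.

Lemma oriented_Rintegral_by_parts (R : realType) (l r x0 k : R) (h f : R -> R) :
  l < r -> lebesgue_measure.-integrable `[l, r] (EFin \o h) -> x0 \in `[l, r] ->
  test_function `]l, r[%classic f ->
  \int[lebesgue_measure]_(x in `[l, r])
    ((k + oriented_Rintegral x0 x h) * f^`()%classic x)
  = - \int[lebesgue_measure]_(x in `[l, r]) (h x * f x).
Proof.
move=> lr ih x0lr tf; have [df cf' _ _] := tf; have cf := test_function_continuous tf.
have fl : f l = 0 by apply: test_function_eq0 tf _; rewrite in_itv/= ltxx.
have fr : f r = 0 by apply: test_function_eq0 tf _; rewrite in_itv/= ltxx andbF.
have mlr : measurable `[l, r]%classic by exact: measurable_itv.
have cf'' : {within `[l, r], continuous f^`()%classic} by exact: continuous_subspaceT.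
have if' : lebesgue_measure.-integrable `[l, r] (EFin \o f^`()%classic).
  by apply: continuous_compact_integrable => //; exact: segment_compact.
(* The change of base point from [x0] to [l] costs a constant, merged with [k]. Against f' it
   contributes K (f(r) - f(l)) = 0. *)
pose K := k - \int[lebesgue_measure]_(t in `[l, x0]) h t.
transitivity (\int[lebesgue_measure]_(x in `[l, r]) (K * f^`()%classic x +
    (\int[lebesgue_measure]_(t in `[l, x]) h t) * f^`()%classic x)).
  apply: eq_Rintegral => x /set_mem xlr.
  by rewrite (oriented_RintegralE ih x0lr xlr) /K; ring.
rewrite RintegralD//; last 2 first.
- apply: integrable_continuous_mul if'.
  by apply: continuous_subspaceT; exact: cst_continuous.
- apply: integrable_continuous_mul if'.
  exact: (parameterized_integral_continuous (ltW lr) ih).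
rewrite integral_primitive_mul_derive// RintegralZl//.
rewrite {1}/Rintegral (@continuous_FTC2 _ _ f)// ?fl ?fr ?subee// ?mulr0 ?add0r//.
split => //.
- by apply: cvg_at_right_filter; exact: cf.
- by apply: cvg_at_left_filter; exact: cf.
Qed.

(** * Formal powers *)

Lemma Re_mulrC (R : rcfType) (z : R[i]) (x : R) : complex.Re (z * x%:C) = complex.Re z * x.
Proof. by case: z => p q /=; rewrite mulr0 subr0. Qed.

Lemma Im_mulrC (R : rcfType) (z : R[i]) (x : R) : complex.Im (z * x%:C) = complex.Im z * x.
Proof. by case: z => p q /=; rewrite mulr0 add0r. Qed.

Lemma complex_eqP (R : rcfType) (z w : R[i]) :
  complex.Re z = complex.Re w -> complex.Im z = complex.Im w -> z = w.
Proof. by case: z w => [p q] [s t] /= -> ->. Qed.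

Lemma inv_real_complex (R : rcfType) (x : R) : (x%:C)^-1 = (x^-1)%:C.
Proof. by rewrite fmorphV. Qed.

(** Componentwise, to match the first two clauses of [continuous_rep]. *)
Definition ccontinuous (R : realType) (A : set R) (v : R -> R[i]) : Prop :=
  {within A, continuous (fun x => complex.Re (v x))} /\
  {within A, continuous (fun x => complex.Im (v x))}.

Definition cmeasurable (R : realType) (A : set R) (v : R -> R[i]) : Prop :=
  measurable_fun A (fun x => complex.Re (v x)) /\
  measurable_fun A (fun x => complex.Im (v x)).

Lemma ccontinuous_cst (R : realType) (A : set R) (z : R[i]) : ccontinuous A (fun=> z).
Proof. by split; apply: continuous_subspaceT; exact: cst_continuous. Qed.

Lemma ccontinuous_linear (R : realType) (A : set R) (z : R[i]) (v w : R -> R[i]) :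
  ccontinuous A v -> ccontinuous A w -> ccontinuous A (fun x => z * v x + w x).
Proof.
case: z => p q [cv1 cv2] [cw1 cw2]; split.
- rewrite (_ : (fun _ => _) = fun x => p * complex.Re (v x) - q * complex.Im (v x)
      + complex.Re (w x)); last by apply/funext => x /=; case: (v x) (w x) => [? ?] [? ?].
  move=> x; apply: cvgD; last exact: cw1.
  by apply: cvgB; apply: cvgM; [exact: cvg_cst|exact: cv1|exact: cvg_cst|exact: cv2].
- rewrite (_ : (fun _ => _) = fun x => p * complex.Im (v x) + q * complex.Re (v x)
      + complex.Im (w x)); last by apply/funext => x /=; case: (v x) (w x) => [? ?] [? ?].
  move=> x; apply: cvgD; last exact: cw2.
  by apply: cvgD; apply: cvgM; [exact: cvg_cst|exact: cv2|exact: cvg_cst|exact: cv1].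
Qed.

Lemma ccontinuous_sum (R : realType) (A : set R) (n : nat) (z : nat -> R[i])
    (v : nat -> R -> R[i]) : (forall k, ccontinuous A (v k)) ->
  ccontinuous A (fun x => \sum_(k < n) z k * v k x).
Proof.
move=> cv; elim: n => [|n IH].
  rewrite (_ : (fun _ => _) = fun=> 0); first exact: ccontinuous_cst.
  by apply/funext => x; rewrite big_ord0.
rewrite (_ : (fun _ => _) = fun x => z n * v n x + \sum_(k < n) z k * v k x).
  exact: ccontinuous_linear.
by apply/funext => x; rewrite big_ord_recr addrC.
Qed.

Lemma J_opE (R : realType) (a : R -> R) (x0 x : R) (v : R -> R[i]) :
  J_op a x0 v x =
    (oriented_Rintegral x0 x (fun t => complex.Re (v t) * (a t ^+ 2)^-1)) +i*
    (oriented_Rintegral x0 x (fun t => complex.Im (v t) * (a t ^+ 2)^-1)).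
Proof.
have H A : Cintegral A (fun t => v t / (a t ^+ 2)%:C) =
    (\int[lebesgue_measure]_(t in A) (complex.Re (v t) * (a t ^+ 2)^-1)) +i*
    (\int[lebesgue_measure]_(t in A) (complex.Im (v t) * (a t ^+ 2)^-1)).
  by congr (_ +i* _); apply: eq_Rintegral => t _; rewrite inv_real_complex ?Re_mulrC ?Im_mulrC.
rewrite /J_op /oriented_integral /oriented_Rintegral !H; case: ifP => // _.
Qed.

(** This is 1/a in L^2, stated on the closed interval because [x0] and [x] may be endpoints outside
    [I]. *)
Definition weight_integrable (R : realType) (l r : R) (a : R -> R) : Prop :=
  lebesgue_measure.-integrable `[l, r] (EFin \o (fun t => (a t ^+ 2)^-1)).

Lemma J_op_linear (R : realType) (l r x0 x : R) (a : R -> R) (z : R[i])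
    (v w : R -> R[i]) : weight_integrable l r a ->
  ccontinuous `[l, r] v -> ccontinuous `[l, r] w ->
  x0 \in `[l, r] -> x \in `[l, r] ->
  J_op a x0 (fun t => z * v t + w t) x = z * J_op a x0 v x + J_op a x0 w x.
Proof.
move=> wa [cv1 cv2] [cw1 cw2] x0lr xlr; rewrite !J_opE; case: z => p q.
set b := fun t => (a t ^+ 2)^-1.
have iv1 := integrable_continuous_mul cv1 wa.
have iv2 := integrable_continuous_mul cv2 wa.
have iw1 := integrable_continuous_mul cw1 wa.
have iw2 := integrable_continuous_mul cw2 wa.
have ilin s (h k : R -> R) : lebesgue_measure.-integrable `[l, r] (EFin \o h) ->
    lebesgue_measure.-integrable `[l, r] (EFin \o k) ->
    lebesgue_measure.-integrable `[l, r] (EFin \o (fun t => s * h t + k t)).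
  move=> ih ik.
  have ish : lebesgue_measure.-integrable `[l, r] (EFin \o (fun t => s * h t)).
    by apply: integrable_continuous_mul ih; apply: continuous_subspaceT; exact: cst_continuous.
  by apply: (integrableD _ ish ik); exact: measurable_itv.
apply: complex_eqP => /=.
- transitivity (oriented_Rintegral x0 x (fun t => p * (complex.Re (v t) * b t) +
    (- q * (complex.Im (v t) * b t) + complex.Re (w t) * b t))).
    congr oriented_Rintegral; apply/funext => t.
    by case: (v t) (w t) => [? ?] [? ?] /=; rewrite /b; ring.
  rewrite (oriented_Rintegral_linear p iv1 (ilin (- q) _ _ iv2 iw1) x0lr xlr).
  by rewrite (oriented_Rintegral_linear (- q) iv2 iw1 x0lr xlr); ring.
- transitivity (oriented_Rintegral x0 x (fun t => p * (complex.Im (v t) * b t) +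
    (q * (complex.Re (v t) * b t) + complex.Im (w t) * b t))).
    congr oriented_Rintegral; apply/funext => t.
    by case: (v t) (w t) => [? ?] [? ?] /=; rewrite /b; ring.
  rewrite (oriented_Rintegral_linear p iv2 (ilin q _ _ iv1 iw2) x0lr xlr).
  by rewrite (oriented_Rintegral_linear q iv1 iw2 x0lr xlr); ring.
Qed.

Lemma J_op0 (R : realType) (a : R -> R) (x0 x : R) : J_op a x0 (fun=> 0) x = 0.
Proof.
have H (h : R -> R) : oriented_Rintegral x0 x (fun t => 0 * h t) = 0.
  rewrite /oriented_Rintegral.
  by case: ifP => _; (under eq_Rintegral do rewrite mul0r);
    rewrite Rintegral_cst ?mul0r ?oppr0//; exact: measurable_itv.
by rewrite J_opE /= !H.
Qed.

Lemma J_op_id (R : realType) (a : R -> R) (x0 : R) (v : R -> R[i]) : J_op a x0 v x0 = 0.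
Proof. by rewrite J_opE /oriented_Rintegral lexx set_itv1 !Rintegral_set1. Qed.

(** Identities between formal powers are available on [l, r] only, not as equalities of functions;
    this allows them to be used under [J_op]. *)
Lemma eq_J_op (R : realType) (l r x0 x : R) (a : R -> R) (v w : R -> R[i]) :
  {in `[l, r], v =1 w} -> x0 \in `[l, r] -> x \in `[l, r] ->
  J_op a x0 v x = J_op a x0 w x.
Proof.
rewrite !in_itv/= => vw /andP[lx0 x0r] /andP[lx xr].
have H y z : l <= y -> z <= r -> Cintegral `[y, z] (fun t => v t / (a t ^+ 2)%:C) =
    Cintegral `[y, z] (fun t => w t / (a t ^+ 2)%:C).
  move=> ly zr; congr (_ +i* _); apply: eq_Rintegral => t /set_mem /=;
    rewrite in_itv/= => /andP[yt tz];
    by rewrite vw// in_itv/= (le_trans ly yt) (le_trans tz zr).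
by rewrite /J_op /oriented_integral !H.
Qed.

Lemma J_op_sum (R : realType) (l r x0 x : R) (a : R -> R) (n : nat) (z : nat -> R[i])
    (v : nat -> R -> R[i]) : weight_integrable l r a ->
  (forall k, ccontinuous `[l, r] (v k)) -> x0 \in `[l, r] -> x \in `[l, r] ->
  J_op a x0 (fun t => \sum_(k < n) z k * v k t) x = \sum_(k < n) z k * J_op a x0 (v k) x.
Proof.
move=> wa cv x0lr xlr; elim: n => [|n IH].
  rewrite big_ord0 -[RHS](J_op0 a x0 x); congr J_op; apply/funext => t.
  by rewrite big_ord0.
rewrite big_ord_recr /= -IH addrC -(J_op_linear _ wa)//; last exact: ccontinuous_sum.
by congr J_op; apply/funext => t; rewrite big_ord_recr addrC.
Qed.

Lemma J_op_scale (R : realType) (l r x0 x : R) (a : R -> R) (z : R[i]) (v : R -> R[i]) :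
  weight_integrable l r a -> ccontinuous `[l, r] v -> x0 \in `[l, r] -> x \in `[l, r] ->
  J_op a x0 (fun t => z * v t) x = z * J_op a x0 v x.
Proof.
move=> wa cv x0lr xlr.
have := J_op_linear z wa cv (ccontinuous_cst _ 0) x0lr xlr; rewrite J_op0 addr0 => <-.
by congr J_op; apply/funext => t; rewrite addr0.
Qed.

Lemma ccontinuous_J_op (R : realType) (l r x0 : R) (a : R -> R) (v : R -> R[i]) :
  weight_integrable l r a -> ccontinuous `[l, r] v -> x0 \in `[l, r] ->
  ccontinuous `[l, r] (J_op a x0 v).
Proof.
move=> wa [cv1 cv2] x0lr; split.
- rewrite (_ : (fun _ => _) = fun x => oriented_Rintegral x0 x
    (fun t => complex.Re (v t) * (a t ^+ 2)^-1)); last by apply/funext => x; rewrite J_opE.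
  by apply: oriented_Rintegral_continuous => //; exact: integrable_continuous_mul.
- rewrite (_ : (fun _ => _) = fun x => oriented_Rintegral x0 x
    (fun t => complex.Im (v t) * (a t ^+ 2)^-1)); last by apply/funext => x; rewrite J_opE.
  by apply: oriented_Rintegral_continuous => //; exact: integrable_continuous_mul.
Qed.

Lemma inv_impK (R : realType) (a : R -> R) : inv_imp (inv_imp a) = a.
Proof. by apply/funext => x; rewrite /inv_imp invrK. Qed.

Lemma inv_alt_imp (R : realType) (a : R -> R) (m : nat) :
  alt_imp (inv_imp a) m = alt_imp a m.+1.
Proof. by rewrite /alt_imp /=; case: odd; rewrite ?inv_impK. Qed.

Lemma inv_alt_impS (R : realType) (a : R -> R) (m : nat) :
  inv_imp (alt_imp a m) = alt_imp a m.+1.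
Proof. by rewrite /alt_imp /=; case: odd; rewrite ?inv_impK. Qed.

Lemma formal_power_ccontinuous (R : realType) (l r x0 : R) (a : R -> R) (n : nat) :
  weight_integrable l r a -> weight_integrable l r (inv_imp a) -> x0 \in `[l, r] ->
  ccontinuous `[l, r] (formal_power a x0 n).
Proof.
move=> wa wi x0lr; elim/ltn_ind: n => -[|[|n]] IH.
- exact: ccontinuous_cst.
- by apply: ccontinuous_J_op => //; exact: ccontinuous_cst.
- have cn := IH n (leqW (leqnn _)).
  have cJ := ccontinuous_J_op wa (ccontinuous_J_op wi cn x0lr) x0lr.
  have := ccontinuous_linear (n.+2 * n.+1)%:R cJ (ccontinuous_cst _ 0).
  by congr ccontinuous; apply/funext => x; rewrite addr0.
Qed.

(** The definition descends by two with a fixed impedance; descending by one alternates [a] and 1/a,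
    as [J_iter] and [D_iter] do. Since the inductive hypothesis is used for 1/a, the induction
    ranges over all impedances. *)
Lemma formal_powerS (R : realType) (l r x0 x : R) (a : R -> R) (n : nat) :
  weight_integrable l r a -> weight_integrable l r (inv_imp a) ->
  x0 \in `[l, r] -> x \in `[l, r] ->
  formal_power a x0 n.+1 x = n.+1%:R * J_op a x0 (formal_power (inv_imp a) x0 n) x.
Proof.
move=> wa wi x0lr; elim/ltn_ind: n a wa wi x => -[|n] IH a wa wi x xlr.
  by rewrite mul1r.
have cn := formal_power_ccontinuous n wa wi x0lr.
rewrite [LHS]/= natrM -mulrA; congr (_ * _).
rewrite -(J_op_scale _ wa)//; last exact: ccontinuous_J_op.
by apply: (@eq_J_op _ l r) => // t tlr; rewrite IH ?inv_impK.
Qed.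

Lemma J_iterE (R : realType) (l r x0 x : R) (a : R -> R) (m : nat) :
  weight_integrable l r a -> weight_integrable l r (inv_imp a) ->
  x0 \in `[l, r] -> x \in `[l, r] ->
  J_iter a x0 m (fun=> 1) x = (m`!%:R)^-1 * formal_power a x0 m x.
Proof.
(* [J_iter] is defined by splitting off the innermost integral; [formal_powerS] has the outermost
   one in front, so the recursion is first turned around. *)
have JS b k v : J_iter b x0 k.+1 v = J_op b x0 (J_iter (inv_imp b) x0 k v).
  elim: k v => //= k IH v; rewrite -IH /= inv_alt_imp //.
move=> wa wi x0lr; elim: m a wa wi x => [|m IH] a wa wi x xlr.
  by rewrite /= invr1 mul1r.
rewrite JS (formal_powerS _ wa wi)// (@eq_J_op _ l r _ _ _ _
  (fun t => (m`!%:R)^-1 * formal_power (inv_imp a) x0 m t))//; last first.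
  by move=> t tlr; rewrite IH// inv_impK.
rewrite (J_op_scale _ wa)//; last by apply: formal_power_ccontinuous; rewrite ?inv_impK.
by rewrite mulrA factS natrM invfM [_ * (m.+1)%:R]mulrC mulVKf// pnatr_eq0.
Qed.

(** * Weak derivatives *)

Lemma ae_itv_bndoo (R : realType) (l r : R) (b c : bool) (P : R -> Prop) :
  {ae lebesgue_measure, forall x, x \in `]l, r[ -> P x} ->
  {ae lebesgue_measure, forall x, [set` Interval (BSide b l) (BSide c r)] x -> P x}.
Proof.
have fae := ae_filter_ringOfSetsType (@lebesgue_measure R).
have ae_neq (y : R) : {ae lebesgue_measure, forall x : R, x != y}.
  exists [set y]; split; [exact: measurable_set1|exact: lebesgue_measure_set1|].
  by move=> x /= /negP; rewrite negbK => /eqP.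
move: (ae_neq l) (ae_neq r) => hl hr H.
move: hl hr H; apply: filterS3 => x /= xl xr Px xI; apply: Px.
rewrite in_itv/= !lt_neqAle eq_sym xl xr/=.
have : x \in `[l, r] by apply: (subset_itvScc _ _ xI); rewrite bnd_simp.
by rewrite in_itv.
Qed.

(** [u] is tied to the primitive only almost everywhere because it will be an iterate of [D_op]; its
    measurability is then a separate hypothesis. The proof replaces [u] by the continuous primitive
    [w] and compares integrals on ]l, r[. *)
Lemma primitive_weak_derivative (R : realType) (l r x0 k : R) (b c : bool)
    (u h : R -> R) (I := [set` Interval (BSide b l) (BSide c r)]) :
  l < r -> lebesgue_measure.-integrable `[l, r] (EFin \o h) -> x0 \in `[l, r] ->
  measurable_fun I u ->
  {ae lebesgue_measure, forall x, I x -> u x = k + oriented_Rintegral x0 x h} ->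
  [/\ lebesgue_measure.-integrable I (EFin \o u),
      lebesgue_measure.-integrable I (EFin \o h)
    & forall f, test_function I f ->
        \int[lebesgue_measure]_(x in I) (u x * f^`()%classic x)
        = - \int[lebesgue_measure]_(x in I) (h x * f x)].
Proof.
move=> lr ih x0lr mu uE.
have mI : measurable I by exact: measurable_itv.
have mlr : measurable `[l, r]%classic by exact: measurable_itv.
have Ilr : I `<=` `[l, r] by apply: subset_itvScc; rewrite bnd_simp.
have oolr : `]l, r[ `<=` `[l, r] by apply: subset_itvScc; rewrite bnd_simp.
set w := fun x => k + oriented_Rintegral x0 x h.
have cw : {within `[l, r], continuous w}.
  move=> x; apply: cvgD; first exact: cvg_cst.
  exact: (oriented_Rintegral_continuous ih x0lr).
have iw : lebesgue_measure.-integrable `[l, r] (EFin \o w).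
  by apply: continuous_compact_integrable => //; exact: segment_compact.
have uw : {ae lebesgue_measure, forall x, I x -> w x = u x}.
  have fae := ae_filter_ringOfSetsType (@lebesgue_measure R).
  by move: uE; apply: filterS => x /= H /H ->.
split.
- apply: ae_eq_integrable uw _ => //; exact: integrableS iw.
- exact: integrableS ih.
move=> f tf; have tf' := (test_function_itv _ _ _ _ _).1 tf.
have [df cf' _ _] := tf; have cf := test_function_continuous tf.
have mf' A : measurable A -> measurable_fun A f^`()%classic.
  by move=> mA; apply: measurable_funTS; exact: continuous_measurable_fun.
have mf A : measurable A -> measurable_fun A f.
  by move=> mA; apply: measurable_funTS; exact: continuous_measurable_fun.
have mw A : measurable A -> A `<=` `[l, r] -> measurable_fun A w.
  move=> mA As; apply: measurable_funS As _ => //.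
  exact: subspace_continuous_measurable_fun.
have mh A : measurable A -> A `<=` `[l, r] -> measurable_fun A h.
  move=> mA As; apply: measurable_funS As _ => //.
  by apply/measurable_EFinP; exact: (measurable_int _ ih).
have moo : measurable `]l, r[%classic by exact: measurable_itv.
rewrite -(@ae_eq_Rintegral _ I (fun x => w x * f^`()%classic x)) //; last 3 first.
- by apply: measurable_funM; [exact: mw|exact: mf'].
- by apply: measurable_funM; [exact: mu|exact: mf'].
- have fae := ae_filter_ringOfSetsType (@lebesgue_measure R).
  by move: uw; apply: filterS => x /= H /H ->.
rewrite /I !(@Rintegral_itv_bndoo _ l r b c); last 2 first.
- by apply: measurable_funM; [exact: mh|exact: mf].
- by apply: measurable_funM; [exact: mw|exact: mf'].
have := oriented_Rintegral_by_parts k lr ih x0lr tf'.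
rewrite !(@Rintegral_itv_bndoo _ l r true false)//.
- by apply: measurable_funM; [exact: mh|exact: mf].
- by apply: measurable_funM; [exact: mw|exact: mf'].
Qed.

(** Test functions are real, so the defining identity splits into real and imaginary parts, and du
    Bois-Reymond applies to each difference. *)
Lemma weak_derivative_uniq (R : realType) (l r : R) (b c : bool) (u g1 g2 : R -> R[i])
    (I := [set` Interval (BSide b l) (BSide c r)]) :
  weak_derivative I u g1 -> weak_derivative I u g2 -> g1 = g2 %[ae lebesgue_measure in I].
Proof.
move=> [[ir1 ii1] w1] [[ir2 ii2] w2].
have fae := ae_filter_ringOfSetsType (@lebesgue_measure R).
have mI : measurable I by exact: measurable_itv.
have moo : measurable `]l, r[%classic by exact: measurable_itv.
have ooI : `]l, r[ `<=` I by apply: subset_itv; rewrite bnd_simp.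
have H (h1 h2 : R -> R) : lebesgue_measure.-integrable I (EFin \o h1) ->
    lebesgue_measure.-integrable I (EFin \o h2) ->
    (forall f, test_function I f -> \int[lebesgue_measure]_(x in I) (h1 x * f x) =
       \int[lebesgue_measure]_(x in I) (h2 x * f x)) ->
    {ae lebesgue_measure, forall x, I x -> h1 x = h2 x}.
  have ioo (h : R -> R) : lebesgue_measure.-integrable I (EFin \o h) ->
    lebesgue_measure.-integrable `]l, r[ (EFin \o h) by exact: integrableS.
  move=> /ioo i1 /ioo i2 E.
  have : {ae lebesgue_measure, forall x, x \in `]l, r[ -> h1 x - h2 x = 0}.
    apply: du_bois_reymond; first exact: (integrableB _ i1 i2).
    move=> f tf; have cf := test_function_continuous tf.
    have mf : measurable_fun `]l, r[ f.
      by apply: measurable_funTS; exact: continuous_measurable_fun.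
    have bf : [bounded f x | x in `]l, r[%classic].
      have [M [rM fM]] := @segment_continuous_bounded R l r f (continuous_subspaceT cf).
      exists M; split => // y My x xlr; apply: fM My _ _.
      by apply: (subset_itvScc _ _ xlr); rewrite bnd_simp.
    have j1 := @integrableMl _ _ _ lebesgue_measure _ moo _ f i1 mf bf.
    have j2 := @integrableMl _ _ _ lebesgue_measure _ moo _ f i2 mf bf.
    have := E f ((test_function_itv _ _ _ _ _).2 tf).
    rewrite /I !(@Rintegral_itv_bndoo _ l r b c); last 2 first.
    - by apply/measurable_EFinP; exact: (measurable_int _ j2).
    - by apply/measurable_EFinP; exact: (measurable_int _ j1).
    move=> E'; under eq_Rintegral do rewrite mulrBl.
    by rewrite RintegralB// E' subrr.
  move=> /(@ae_itv_bndoo R l r b c); apply: filterS => x /= E' /E'/eqP.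
  by rewrite subr_eq0 => /eqP.
have RE (g : R -> R[i]) f : complex.Re (Cintegral I (fun x => g x * (f x)%:C)) =
    \int[lebesgue_measure]_(x in I) (complex.Re (g x) * f x).
  by apply: eq_Rintegral => x _; rewrite Re_mulrC.
have IE (g : R -> R[i]) f : complex.Im (Cintegral I (fun x => g x * (f x)%:C)) =
    \int[lebesgue_measure]_(x in I) (complex.Im (g x) * f x).
  by apply: eq_Rintegral => x _; rewrite Im_mulrC.
have E f : test_function I f -> Cintegral I (fun x => g1 x * (f x)%:C) =
    Cintegral I (fun x => g2 x * (f x)%:C).
  by move=> tf; apply: oppr_inj; rewrite -w1// -w2.
have Hr := H _ _ ir1 ir2 (fun f tf =>
  etrans (esym (RE g1 f)) (etrans (congr1 _ (E f tf)) (RE g2 f))).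
have Hi := H _ _ ii1 ii2 (fun f tf =>
  etrans (esym (IE g1 f)) (etrans (congr1 _ (E f tf)) (IE g2 f))).
move: Hr Hi; apply: filterS2 => x /= h1 h2 Ix.
by apply: complex_eqP; [exact: h1|exact: h2].
Qed.

Lemma wderiveP (R : realType) (I : set R) (u g : R -> R[i]) :
  weak_derivative I u g -> weak_derivative I u (wderive I u).
Proof. exact: xgetI. Qed.

Lemma proper_impedance_inv (R : realType) (I : set R) (a : R -> R) :
  proper_impedance I a -> proper_impedance I (inv_imp a).
Proof.
move=> [a0 sa si]; split => //; last by rewrite inv_impK.
by move=> x Ix; rewrite invr_gt0 a0.
Qed.

Lemma proper_impedance_alt (R : realType) (I : set R) (a : R -> R) (m : nat) :
  proper_impedance I a -> proper_impedance I (alt_imp a m).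
Proof. by move=> pa; rewrite /alt_imp; case: odd => //; exact: proper_impedance_inv. Qed.

Lemma proper_weight_integrable (R : realType) (l r : R) (b c : bool) (a : R -> R)
    (I := [set` Interval (BSide b l) (BSide c r)]) :
  proper_impedance I a -> weight_integrable l r a.
Proof.
move=> [_ _ [_ ia]]; apply: (@integrable_itv_bndoo R l r true false).
have ioo : lebesgue_measure.-integrable `]l, r[ (EFin \o (fun x => inv_imp a x ^+ 2)).
  apply: integrableS ia; [exact: measurable_itv|exact: measurable_itv|].
  by apply: subset_itv; rewrite bnd_simp.
by move: ioo; congr (_.-integrable _ _); apply/funext => x /=; rewrite /inv_imp exprVn.
Qed.

(** The quotient v / a^2 is a weak derivative of [u]; the selected [wderive] agrees with it almost
    everywhere, and multiplying by a^2 restores [v]. Hypotheses and conclusions both speak of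
    measurability and almost everywhere equality, so that the lemma can be iterated. *)
Lemma D_op_primitive (R : realType) (l r x0 : R) (b c : bool) (a : R -> R) (z : R[i])
    (u v : R -> R[i]) (I := [set` Interval (BSide b l) (BSide c r)]) :
  l < r -> proper_impedance I a -> x0 \in `[l, r] -> ccontinuous `[l, r] v ->
  cmeasurable I u ->
  u = (fun x => z + J_op a x0 v x) %[ae lebesgue_measure in I] ->
  [/\ W11 I u, cmeasurable I (D_op I a u)
    & D_op I a u = v %[ae lebesgue_measure in I]].
Proof.
move=> lr pa x0lr [cv1 cv2] [mu1 mu2] uE.
have fae := ae_filter_ringOfSetsType (@lebesgue_measure R).
have wa := proper_weight_integrable pa.
have [a0 [ma _] _] := pa.
have iv1 := integrable_continuous_mul cv1 wa.
have iv2 := integrable_continuous_mul cv2 wa.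
have [||iu1 ig1 w1] := @primitive_weak_derivative R l r x0 (complex.Re z) b c
    (fun x => complex.Re (u x)) (fun t => complex.Re (v t) * (a t ^+ 2)^-1) lr iv1 x0lr.
- exact: mu1.
- by move: uE; apply: filterS => x /= H Ix; rewrite H// J_opE; case: (z).
have [||iu2 ig2 w2] := @primitive_weak_derivative R l r x0 (complex.Im z) b c
    (fun x => complex.Im (u x)) (fun t => complex.Im (v t) * (a t ^+ 2)^-1) lr iv2 x0lr.
- exact: mu2.
- by move: uE; apply: filterS => x /= H Ix; rewrite H// J_opE; case: (z).
set g := fun t => v t / (a t ^+ 2)%:C.
have ReE : (fun t => complex.Re (g t)) = (fun t => complex.Re (v t) * (a t ^+ 2)^-1).
  by apply/funext => t; rewrite /g inv_real_complex Re_mulrC.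
have ImE : (fun t => complex.Im (g t)) = (fun t => complex.Im (v t) * (a t ^+ 2)^-1).
  by apply/funext => t; rewrite /g inv_real_complex Im_mulrC.
have wg : weak_derivative I u g.
  split; first by split; rewrite ?ReE ?ImE.
  have CE (h : R -> R[i]) f : Cintegral I (fun x => h x * (f x)%:C) =
      (\int[lebesgue_measure]_(x in I) (complex.Re (h x) * f x)) +i*
      (\int[lebesgue_measure]_(x in I) (complex.Im (h x) * f x)).
    by congr (_ +i* _); apply: eq_Rintegral => x _; rewrite ?Re_mulrC ?Im_mulrC.
  move=> f tf; rewrite !CE w1// w2//.
  by congr (- _ +i* - _); apply: eq_Rintegral => x _;
    rewrite -?(congr1 (@^~ x) ReE) -?(congr1 (@^~ x) ImE).
have wd := wderiveP wg.
split.
- by split; [split|exists g].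
- have [[im1 im2] _] := wd.
  have ma2 : measurable_fun I (fun x => a x ^+ 2) by exact: measurable_funX.
  split; rewrite /D_op.
  + rewrite (_ : (fun _ => _) = fun x => complex.Re (wderive I u x) * a x ^+ 2).
      by apply: measurable_funM => //; apply/measurable_EFinP; exact: (measurable_int _ im1).
    by apply/funext => x; rewrite mulrC Re_mulrC.
  + rewrite (_ : (fun _ => _) = fun x => complex.Im (wderive I u x) * a x ^+ 2).
      by apply: measurable_funM => //; apply/measurable_EFinP; exact: (measurable_int _ im2).
    by apply/funext => x; rewrite mulrC Im_mulrC.
- move: (weak_derivative_uniq wd wg); apply: filterS => x /= H Ix.
  (* The cancellation is made at points of [I] only, where [a] is known to be positive. *)
  rewrite /D_op H// /g mulrC mulfVK//.
  by rewrite fmorph_eq0 expf_neq0// gt_eqF// a0.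
Qed.

(** * Generalized derivatives of combinations of formal powers *)

Lemma ffact_formal_powerE (R : realType) (l r x0 x : R) (a : R -> R) (j k : nat) :
  (forall m, weight_integrable l r (alt_imp a m)) ->
  x0 \in `[l, r] -> x \in `[l, r] ->
  (j ^_ k)%:R * formal_power (alt_imp a k) x0 (j - k) x =
  (if j == k then k`!%:R else 0)
  + (j ^_ k.+1)%:R * J_op (alt_imp a k) x0 (formal_power (alt_imp a k.+1) x0 (j - k.+1)) x.
Proof.
(* For j < k both falling factorials vanish, which makes the truncated subtractions harmless; for j
   > k this is [formal_powerS]; for j = k only the constant k! remains. *)
move=> wa x0lr xlr; case: (ltngtP j k) => [jk|kj|->].
- by rewrite !ffact_small ?mul0r ?addr0// ltnW.
- rewrite add0r -inv_alt_impS ffactnSr natrM.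
  have -> : (j - k = (j - k.+1).+1)%N by rewrite subnSK.
  rewrite (formal_powerS _ (wa k) _ x0lr xlr) ?inv_alt_impS//.
  by rewrite mulrA.
- by rewrite ffactnn subnn /= mulr1 ffact_small// mul0r addr0.
Qed.

(* The value predicted for [D_a^(k)] of [\sum_j alpha_j phi_a^(j)]. *)
Definition formal_derivative (R : realType) (a : R -> R) (x0 : R) (N : nat)
    (alpha : nat -> R[i]) (k : nat) (x : R) : R[i] :=
  \sum_(j < N) alpha j * (j ^_ k)%:R * formal_power (alt_imp a k) x0 (j - k) x.

Lemma formal_derivative_ccontinuous (R : realType) (l r x0 : R) (a : R -> R) (N : nat)
    (alpha : nat -> R[i]) (k : nat) :
  (forall m, weight_integrable l r (alt_imp a m)) -> x0 \in `[l, r] ->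
  ccontinuous `[l, r] (formal_derivative a x0 N alpha k).
Proof.
move=> wa x0lr.
apply: (ccontinuous_sum N (fun j => alpha j * (j ^_ k)%:R)
  (v := fun j => formal_power (alt_imp a k) x0 (j - k))) => j.
by apply: formal_power_ccontinuous => //; rewrite inv_alt_impS.
Qed.

(** This is the shape z + J v required by [D_op_primitive], with [v] the next formal derivative. As
    J v vanishes at x0, it also gives the value there. *)
Lemma formal_derivativeE (R : realType) (l r x0 x : R) (a : R -> R) (N : nat)
    (alpha : nat -> R[i]) (k : nat) :
  (forall m, weight_integrable l r (alt_imp a m)) ->
  x0 \in `[l, r] -> x \in `[l, r] ->
  formal_derivative a x0 N alpha k x =
  (if (k < N)%N then alpha k * k`!%:R else 0)
  + J_op (alt_imp a k) x0 (formal_derivative a x0 N alpha k.+1) x.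
Proof.
move=> wa x0lr xlr.
rewrite (J_op_sum N (fun j => alpha j * (j ^_ k.+1)%:R)
  (v := fun j => formal_power (alt_imp a k.+1) x0 (j - k.+1)) (wa k))//; last first.
  by move=> j; apply: formal_power_ccontinuous => //; rewrite inv_alt_impS.
(* The constant is spread over the sum as its single term j = k, so that the identity can be checked
   term by term. *)
have -> : (if (k < N)%N then alpha k * k`!%:R else 0) =
    \sum_(j < N) alpha j * (if j == k :> nat then k`!%:R else 0).
  case: ifPn => kN.
    rewrite (bigD1 (Ordinal kN))//= eqxx big1 ?addr0// => j jk.
    by rewrite ifN ?mulr0// (contra_neq _ jk)// => jk'; apply/val_inj.
  rewrite big1// => j _; rewrite ifN ?mulr0//.
  by apply: contraNneq kN => <-.
rewrite -big_split; apply: eq_bigr => j _ /=.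
by rewrite -!mulrA -mulrDr (ffact_formal_powerE _ _ wa x0lr xlr).
Qed.

Lemma formal_derivative_x0 (R : realType) (l r x0 : R) (a : R -> R) (N : nat)
    (alpha : nat -> R[i]) (k : nat) :
  (forall m, weight_integrable l r (alt_imp a m)) -> x0 \in `[l, r] -> (k < N)%N ->
  formal_derivative a x0 N alpha k x0 = alpha k * k`!%:R.
Proof.
by move=> wa x0lr kN; rewrite (formal_derivativeE _ _ _ wa x0lr x0lr) kN J_op_id addr0.
Qed.

(** The three conclusions are proved together: applying [D_op_primitive] at order k uses both
    measurability and the formula at that order, and yields membership in W^{1,1} for the next
    domain condition. *)
Lemma D_iter_formal_derivative (R : realType) (l r x0 : R) (b c : bool) (a : R -> R)
    (N : nat) (alpha : nat -> R[i]) (phat : R -> R[i])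
    (I := [set` Interval (BSide b l) (BSide c r)]) (k : nat) :
  l < r -> proper_impedance I a -> x0 \in `[l, r] ->
  (forall x, x \in `[l, r] ->
     phat x = \sum_(j < N) alpha j * formal_power a x0 j x) ->
  [/\ D_iter_dom I a k phat, cmeasurable I (D_iter I a k phat)
    & D_iter I a k phat = formal_derivative a x0 N alpha k %[ae lebesgue_measure in I]].
Proof.
move=> lr pa x0lr phatE.
have pak m := proper_impedance_alt m pa.
have wa m := proper_weight_integrable (pak m).
have mI : measurable I by exact: measurable_itv.
have Ilr : I `<=` `[l, r] by apply: subset_itvScc; rewrite bnd_simp.
elim: k => [|k [dom mk Ek]].
  have E x : I x -> phat x = formal_derivative a x0 N alpha 0 x.
    move=> /Ilr xlr; rewrite phatE//; apply: eq_bigr => j _.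
    by rewrite ffactn0 mulr1 subn0.
  have [c1 c2] := formal_derivative_ccontinuous N alpha 0 wa x0lr.
  split => //; last by apply: aeW => x; exact: E.
  (* [phat] is prescribed on [l, r] only; its measurability on [I] comes from the continuous
     combination it equals there. *)
  have mlr : measurable `[l, r]%classic by exact: measurable_itv.
  have mc (f : R -> R) : {within `[l, r], continuous f} -> measurable_fun I f.
    move=> cf; apply: measurable_funS Ilr _ => //.
    exact: subspace_continuous_measurable_fun.
  split; [apply: eq_measurable_fun (mc _ c1)|apply: eq_measurable_fun (mc _ c2)];
    by move=> x /set_mem Ix /=; rewrite E.
have [|w11 m Ek1] := @D_op_primitive R l r x0 b c (alt_imp a k)
    (if (k < N)%N then alpha k * k`!%:R else 0) (D_iter I a k phat)
    (formal_derivative a x0 N alpha k.+1) lr (pak k) x0lr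
    (formal_derivative_ccontinuous _ _ _ wa x0lr) mk.
  have fae := ae_filter_ringOfSetsType (@lebesgue_measure R).
  move: Ek; apply: filterS => x /= Ek Ix; rewrite Ek//.
  by rewrite (formal_derivativeE _ _ _ wa x0lr)//; exact: Ilr.
split => // j; rewrite ltnS leq_eqVlt => /predU1P[->//|]; exact: dom.
Qed.

Lemma formal_derivative_delta (R : realType) (a : R -> R) (x0 x : R) (n m : nat) :
  formal_derivative a x0 n.+1 (fun j => (j == n)%:R) m x =
  (n ^_ m)%:R * formal_power (alt_imp a m) x0 (n - m) x.
Proof.
rewrite /formal_derivative big_ord_recr /= eqxx mul1r big1 ?add0r// => j _.
by rewrite ltn_eqF ?ltn_ord// !mul0r.
Qed.

Unset Implicit Arguments.

Theorem proposition14 (R : realType) (I : set R) (I_itv : is_interval I)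
  (I_bounded : bounded_set I) (I_nondegenerate : I° !=set0)
  (a : R -> R) (a_proper : proper_impedance I a)
  (x0 : R) (x0_in : closure I x0) :
  [/\ (forall m n : nat,
         D_iter_dom I a m (formal_power a x0 n) /\
         D_iter I a m (formal_power a x0 n)
         = (fun x => if (m <= n)%N
                     then (n ^_ m)%:R * formal_power (alt_imp a m) x0 (n - m) x
                     else 0) %[ae lebesgue_measure in I]),
      (forall (m : nat) (x : R), closure I x ->
         J_iter a x0 m (fun=> 1) x = (m`!%:R)^-1 * formal_power a x0 m x)
    & (forall (N : nat) (alpha : nat -> R[i]) (phat : R -> R[i]),
         (forall x, closure I x ->
            phat x = \sum_(k < N.+1) alpha k * formal_power a x0 k x) ->
         (forall k : nat, (k <= N)%N ->
            D_iter_dom I a k phat /\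
            exists w, continuous_rep I (D_iter I a k phat) w) /\
         (forall x, closure I x ->
            phat x = \sum_(k < N.+1)
              value_at I (D_iter I a k phat) x0 / k`!%:R
                * formal_power a x0 k x))].
Proof.
have [l [r [b [c [lr IE]]]]] := bounded_intervalP I_itv I_bounded I_nondegenerate.
subst I; rewrite closure_itv_bnd// in x0_in *.
have wa m := proper_weight_integrable (proper_impedance_alt m a_proper).
split.
(* Part (i) is the combination whose coefficients are 1 at n and 0 elsewhere; for m > n the falling
   factorial vanishes. *)
- move=> m n; have [|dom _ E] := @D_iter_formal_derivative R l r x0 b c a n.+1
    (fun j => (j == n)%:R) (formal_power a x0 n) m lr a_proper x0_in.
    move=> x _; rewrite big_ord_recr /= eqxx mul1r big1 ?add0r// => j _.
    by rewrite ltn_eqF ?ltn_ord// mul0r.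
  split=> //; have fae := ae_filter_ringOfSetsType (@lebesgue_measure R).
  move: E; apply: filterS => x /= E Ix; rewrite E// formal_derivative_delta.
  by case: leqP => // nm; rewrite ffact_small// mul0r.
(* [alt_imp a 0] and [alt_imp a 1] compute to [a] and [inv_imp a]. *)
- move=> m x xlr; exact: (J_iterE m (wa 0) (wa 1) x0_in xlr).
- move=> N alpha phat phatE.
  have D k := @D_iter_formal_derivative R l r x0 b c a N.+1 alpha phat k
    lr a_proper x0_in phatE.
  set I := [set` _] in D *.
  have rep k : continuous_rep I (D_iter I a k phat) (formal_derivative a x0 N.+1 alpha k).
    have [c1 c2] := formal_derivative_ccontinuous N.+1 alpha k wa x0_in.
    by have [_ _ E] := D k; split; rewrite ?closure_itv_bnd.
  split.
    by move=> k _; have [dom _ _] := D k; split => //; eexists; exact: rep.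
  move=> x xlr; rewrite phatE//; apply: eq_bigr => k _; congr (_ * _).
  suff -> : value_at I (D_iter I a k phat) x0 = formal_derivative a x0 N.+1 alpha k x0.
    by rewrite (formal_derivative_x0 _ wa)// mulfK// pnatr_eq0 -lt0n fact_gt0.
  (* [value_at] evaluates some continuous representative [w]. It agrees almost everywhere with the
     formal derivative, which is another one, so both have the same value at x0. *)
  rewrite /value_at; set S := [set w | _].
  have := @xgetI _ (fun=> 0) S _ (rep k); set w := xget _ _ => -[cw1 cw2 Ew].
  have [c1 c2 Ek] := rep k; rewrite !closure_itv_bnd// in cw1 cw2 c1 c2.
  have fae := ae_filter_ringOfSetsType (@lebesgue_measure R).
  have Ewd : {ae lebesgue_measure, forall y, y \in `]l, r[ ->
      w y = formal_derivative a x0 N.+1 alpha k y}.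
    move: Ew Ek; apply: filterS2 => y /= Ew Ek yoo.
    have Iy : I y by apply: subset_itv yoo; rewrite bnd_simp.
    by rewrite -Ew// -Ek.
  apply: complex_eqP.
  + apply: (ae_eq_within_continuous lr cw1 c1 _ x0_in).
    by move: Ewd; apply: filterS => y /= H /H ->.
  + apply: (ae_eq_within_continuous lr cw2 c2 _ x0_in).
    by move: Ewd; apply: filterS => y /= H /H ->.
Qed.
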